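(* Let $\Delta\in\mathbb{N}$ with $\Delta\ge 3$ and let $\lambda_\Delta:=\frac{(\Delta-1)^{\Delta-1}}{(\Delta-2)^{\Delta}}$. Then there exists a complex domain $D_\Delta\subseteq\mathbb{C}$ containing the real interval $[0,\lambda_\Delta)$ such that for every graph $G=(V,E)$ of maximum degree at most $\Delta$ and every $\lambda\in D_\Delta$ we have $Z_G(\lambda)\neq 0$.
   Context: Graphs are finite and simple. For a graph $G=(V,E)$ and $\lambda\in\mathbb{C}$, the (univariate) independence polynomial is $Z_G(\lambda)=\sum_{I}\lambda^{|I|}$, where the sum is over all independent sets $I\subseteq V$ (sets spanning no edge of $G$, including the empty set). A complex domain is a connected open subset of $\mathbb{C}$. *)

(* Defs.v *)
From HB Require Import structures.
From mathcomp Require Import all_boot all_order all_algebra.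
From mathcomp Require Import all_classical all_reals all_analysis.
From mathcomp Require Import complex.

Set Implicit Arguments.
Unset Strict Implicit.
Unset Printing Implicit Defensive.

Import Order.TTheory GRing.Theory Num.Theory.
Import numFieldNormedType.Exports.

Local Open Scope ring_scope.

Record sgraph := SGraph {
  vertex :> finType;
  edge : rel vertex;
  edge_sym : symmetric edge;
  edge_irrefl : irreflexive edge
}.

Definition degree (G : sgraph) (v : G) : nat := #|edge v|.

Definition max_degree (G : sgraph) : nat := \max_(v : G) degree v.

Definition independent (G : sgraph) (I : {set G}) : bool :=
  [forall u in I, forall v in I, ~~ edge u v].

Definition indep_poly (K : comNzRingType) (G : sgraph) (z : K) : K :=
  \sum_(I : {set G} | independent I) z ^+ #|I|.

Definition lambda_crit (R : realType) (Delta : nat) : R :=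
  (Delta%:R - 1) ^+ (Delta - 1) / (Delta%:R - 2) ^+ Delta.

(* R[i]^o carries the topology of the complex modulus: its neighbourhood
   filters are generated by the balls for the norm of the numFieldType R[i]. *)
Definition complex_domain (R : realType) (D : set R[i]^o) : Prop :=
  open D /\ connected D.

(* Main.v *)
Require Import Defs.
From mathcomp Require Import all_boot all_order all_algebra.
From mathcomp Require Import all_classical all_reals all_analysis.
From mathcomp Require Import complex.
From mathcomp Require Import ring lra.

Import Order.TTheory GRing.Theory Num.Theory.
Import numFieldNormedType.Exports.

Local Open Scope ring_scope.

(** Write d = Delta - 1, and Z_S for the independence polynomial of the
    subgraph induced on a vertex set S, evaluated at z.  For v in S with
    neighbours v_1, ..., v_k inside S, the recurrence
    Z_S = Z_(S - v) + z Z_(S - N[v]) and a telescoping product give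
    Z_S / Z_(S - v) = 1 + z / (p_1 ... p_k), where p_i is again a ratio
    Z_T / Z_(T - v_i), for T = S - v - v_1 - ... - v_(i-1).  Since v has been
    removed, v_i has at most d neighbours in T.  So Z never vanishes as soon as
    some region U of nonzero complex numbers contains 1, is mapped into itself
    by (p_1, ..., p_d) |-> 1 + z / (p_1 ... p_d), and is such that the same
    expression with d + 1 factors is never 0 ([all_controlled]); the last
    condition serves vertices whose Delta neighbours are all still present.

    In the coordinate log p = a + i b a product of ratios becomes a sum, so U is
    taken to be the image under exp of a convex set, and the product of n
    elements of U lies in the image of its n-fold dilate.  The convex set is the
    thin triangle a <= L, |b| <= eps (w + q a) ([sector]).  Let a now be the sum
    of the d logarithmic moduli, and X = l exp(-a) for a real parameter l.  To
    first order in eps, the bound on the arguments is preserved when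
      X (d w + q a) <= (1 + X) (w + q ln (1 + X)).
    At l = lambda_crit the real recursion has the neutral fixed point
    X = 1 / (d - 1); there the inequality has to be an equality, and tangency
    forces w and q up to a common factor.  With these values it reduces to
    u ln u >= u - 1 for u = X (d - 1) and for u = (1 + X) (d - 1) / d
    ([critical_inequality]).  For l bounded away from lambda_crit there is a
    uniform slack, which pays both for the second order effects in eps and for
    a small complex perturbation of l ([sector_ratio]).

    This gives, for every l1 < lambda_crit, a zero-free neighbourhood of [0, l1]
    of uniform width.  The union of these neighbourhoods is open, and connected
    because it is star-shaped about 0. *)

(** * Real inequalities *)

Section real_inequalities.
Set Implicit Arguments.
Unset Strict Implicit.
Variable R : realType.
Implicit Types (x t X a l : R) (d : nat).

Lemma xlnx_ge x : 0 < x -> x - 1 <= x * ln x.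
Proof.
move=> x0; have : ln x^-1 <= x^-1 - 1.
  have -> : x^-1 = 1 + (x^-1 - 1) by ring.
  apply: le_trans (le_ln1Dx _) _; last by lra.
  by rewrite ltrBrDl subrr invr_gt0.
rewrite lnV ?posrE // lerNl => h.
have : x * (1 - x^-1) <= x * ln x by rewrite ler_pM2l //; lra.
by rewrite mulrBr mulr1 mulfV ?gt_eqF.
Qed.

Lemma normr_sin_le x : `|sin x| <= `|x|.
Proof.
wlog x0 : x / 0 <= x.
  move=> h; have [x0|/ltW x0] := leP 0 x; first exact: h.
  by have := h (- x); rewrite sinN !normrN; apply; rewrite oppr_ge0.
have dsub (y : R) : y \in `]0, x[ -> is_derive y 1 sin (cos y).
  by move=> _; exact: is_derive_sin.
have csub : {within `[0, x], continuous (@sin R)}%classic.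
  by apply: continuous_subspaceT => y; exact: continuous_sin.
have [y _] := MVT_segment x0 dsub csub.
rewrite sin0 !subr0 => ->; rewrite normrM ler_piMl //.
by rewrite ler_norml cos_geN1 cos_le1.
Qed.

Lemma cos_ge_sub_norm x : 1 - `|x| <= cos x.
Proof.
wlog x0 : x / 0 <= x.
  move=> h; have [x0|/ltW x0] := leP 0 x; first exact: h.
  by have := h (- x); rewrite cosN normrN; apply; rewrite oppr_ge0.
have dsub (y : R) : y \in `]0, x[ -> is_derive y 1 cos (- sin y).
  by move=> _; exact: is_derive_cos.
have csub : {within `[0, x], continuous (@cos R)}%classic.
  by apply: continuous_subspaceT => y; exact: continuous_cos.
have [y _] := MVT_segment x0 dsub csub.
rewrite cos0 subr0 (ger0_norm x0) => h.
have : - sin y * x >= - 1 * x by rewrite ler_wpM2r // lerN2 sin_le1.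
lra.
Qed.

Lemma normr_atan_le x : `|atan x| <= `|x|.
Proof.
wlog x0 : x / 0 <= x.
  move=> h; have [x0|/ltW x0] := leP 0 x; first exact: h.
  by have := h (- x); rewrite atanN !normrN; apply; rewrite oppr_ge0.
have dsub (y : R) : y \in `]0, x[ -> is_derive y 1 atan (1 + y ^+ 2)^-1.
  by move=> _; exact: is_derive1_atan.
have csub : {within `[0, x], continuous (@atan R)}%classic.
  by apply: continuous_subspaceT => y; exact: continuous_atan.
have [y _] := MVT_segment x0 dsub csub.
rewrite atan0 !subr0 => ->; rewrite normrM ler_piMl //.
have h : 1 <= 1 + y ^+ 2 by rewrite lerDl sqr_ge0.
rewrite ger0_norm ?invr_ge0 ?(le_trans ler01 h) //.
by rewrite invf_le1 // (lt_le_trans ltr01 h).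
Qed.

(** The width of the triangle at logarithmic modulus a is proportional to
    1 + slope d * (a - ln (d / (d - 1))), where ln (d / (d - 1)) is the
    logarithmic fixed point of the critical recursion; [offset d] is the value at a = 0. *)
Definition slope d : R := (d%:R - 1) / 2.
Definition offset d : R := 1 - slope d * ln (d%:R / (d%:R - 1)).

Lemma slope_gt0 d : (1 < d)%N -> 0 < slope d.
Proof. by move=> d1; rewrite /slope divr_gt0 // subr_gt0 ltr1n. Qed.

Lemma offset_gt0 d : (1 < d)%N -> 0 < offset d.
Proof.
move=> d1; have e1 : 0 < d%:R - 1 :> R by rewrite subr_gt0 ltr1n.
have : ln (d%:R / (d%:R - 1) : R) <= (d%:R - 1)^-1.
  have -> : d%:R / (d%:R - 1) = 1 + (d%:R - 1)^-1 :> R by field; rewrite gt_eqF.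
  by apply: le_ln1Dx; rewrite (lt_trans _ (_ : 0 < _)) ?invr_gt0 //; lra.
move/(ler_wpM2l (ltW (slope_gt0 d1))).
have -> : slope d * (d%:R - 1)^-1 = 2^-1 by rewrite /slope; field; rewrite gt_eqF.
by rewrite /offset; lra.
Qed.

Lemma ln_lambda_crit d : (1 < d)%N ->
  ln (lambda_crit R d.+1) =
    d%:R * ln (d%:R / (d%:R - 1)) - ln (d%:R - 1).
Proof.
move=> d1; have e1 : 0 < d%:R - 1 :> R by rewrite subr_gt0 ltr1n.
have e0 : 0 < d%:R :> R by rewrite ltr0n ltnW.
rewrite /lambda_crit subn1 /=.
have -> : d.+1%:R - 1 = d%:R :> R by rewrite -natr1 addrK.
have -> : d.+1%:R - 2 = d%:R - 1 :> R by rewrite -natr1; ring.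
rewrite !ln_div ?posrE ?exprn_gt0 // !lnXn // -[_ *+ d]mulr_natl -[_ *+ d.+1]mulr_natl.
by rewrite -natr1; ring.
Qed.

(** The difference of the two sides is a nonnegative combination of the two
    instances of u ln u >= u - 1 in which u equals 1 at X = 1 / (d - 1). *)
Lemma critical_inequality d X : (1 < d)%N -> 0 < X ->
  X * (d%:R * offset d + slope d * (ln (lambda_crit R d.+1) - ln X))
    <= (1 + X) * (offset d + slope d * ln (1 + X)).
Proof.
move=> d1 X0; have e1 : 0 < d%:R - 1 :> R by rewrite subr_gt0 ltr1n.
have e0 : 0 < d%:R :> R by rewrite ltr0n ltnW.
have X1 : 0 < 1 + X by rewrite addr_gt0.
have q0 := slope_gt0 d1.
have := @xlnx_ge (X * (d%:R - 1)) (mulr_gt0 X0 e1).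
have := @xlnx_ge ((1 + X) * (d%:R - 1) / d%:R) (divr_gt0 (mulr_gt0 X1 e1) e0).
rewrite (ln_lambda_crit d1) /offset !ln_div ?posrE ?mulr_gt0 // !lnM ?posrE //.
set ld := ln d%:R; set le := ln (d%:R - 1); set lX := ln X; set l1X := ln (1 + X).
rewrite /slope; set D := d%:R in e0 e1 *.
move=> h1 h2.
have {}h1 : (1 + X) * (D - 1) - D <= (1 + X) * (D - 1) * (l1X + le - ld).
  have := ler_wpM2l (ltW e0) h1.
  have eD : D * ((1 + X) * (D - 1) / D) = (1 + X) * (D - 1).
    by field; rewrite gt_eqF.
  by rewrite mulrBr mulr1 eD [D * (_ * (_ - _))]mulrA eD.
by lra.
Qed.

(** Lowering l with X = l exp(-a) fixed means lowering a, hence the left-hand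
    side: compared with the critical parameter, the gain is proportional to X. *)
Lemma subcritical_gap d l1 : (1 < d)%N -> 0 < l1 < lambda_crit R d.+1 ->
  exists2 c, 0 < c & forall l a, 0 <= l <= l1 ->
    l * expR (- a) * (d%:R * offset d + slope d * a) + c * (l * expR (- a))
    <= (1 + l * expR (- a)) * (offset d + slope d * ln (1 + l * expR (- a))).
Proof.
move=> d1 /andP[l10 l1c]; have q0 := slope_gt0 d1.
exists (slope d * (ln (lambda_crit R d.+1) - ln l1)).
  by rewrite mulr_gt0 // subr_gt0 ltr_ln ?posrE // (lt_trans l10).
move=> l a /andP[]; rewrite le_eqVlt => /predU1P[<- _|l0 ll1].
  by rewrite !(mul0r, mulr0, addr0) ln1 mul1r mulr0 !addr0 ltW ?offset_gt0.
have X0 : 0 < l * expR (- a) by rewrite mulr_gt0 // expR_gt0.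
apply: le_trans (@critical_inequality d _ d1 X0).
rewrite (lnM (_ : l \in Num.pos)) ?posrE ?expR_gt0 // expRK.
have : ln l <= ln l1 by rewrite ler_ln ?posrE // (lt_le_trans l0).
set X := l * _ in X0 *; move=> h.
have : X * slope d * ln l <= X * slope d * ln l1 by rewrite ler_wpM2l // mulr_ge0 ?ltW.
by lra.
Qed.

End real_inequalities.

(** * Sectors in logarithmic coordinates *)

Section polar_sectors.
Set Implicit Arguments.
Unset Strict Implicit.
Variable R : realType.
Implicit Types (a b : R) (p z : R[i]) (m n : nat).

Definition polar a b : R[i] := ((expR a * cos b) +i* (expR a * sin b))%C.

Lemma polar00 : polar 0 0 = 1.
Proof. by rewrite /polar expR0 cos0 sin0 mulr1 mulr0. Qed.

Lemma polarD a b a' b' : polar (a + a') (b + b') = polar a b * polar a' b'.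
Proof.
rewrite /polar expRD cosD sinD; apply/eqP; rewrite eq_complex /=.
by apply/andP; split; apply/eqP; ring.
Qed.

Lemma polar_neq0 a b : polar a b != 0.
Proof.
have : polar a b * polar (- a) (- b) = 1 by rewrite -polarD !subrr polar00.
by apply: contra_eq_neq => ->; rewrite mul0r eq_sym oner_eq0.
Qed.

Lemma invr_polar a b : (polar a b)^-1 = polar (- a) (- b).
Proof.
apply: (mulfI (polar_neq0 a b)).
by rewrite mulfV ?polar_neq0 // -polarD !subrr polar00.
Qed.

(** Here a + i b is log (x + i y), with b = atan (y / x).  The bound on b is sharp
    to first order in y, which is what the contraction estimate needs. *)
Lemma polar_right_half_plane x y : 0 < x ->
  exists a b, [/\ (x +i* y)%C = polar a b,
    x <= expR a, expR a <= x + `|y| & `|b| <= `|y| / x].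
Proof.
move=> x0; have [t y_def] : exists t, y = t * x.
  by exists (y / x); rewrite divfK ?gt_eqF.
have r0 : 0 < Num.sqrt (1 + t ^+ 2).
  by rewrite sqrtr_gt0 ltr_pwDl ?sqr_ge0.
have r1 : 1 <= Num.sqrt (1 + t ^+ 2).
  by rewrite -[leLHS]sqrtr1 ler_wsqrtr // lerDl sqr_ge0.
have r2 : Num.sqrt (1 + t ^+ 2) <= 1 + `|t|.
  rewrite -(ler_sqr _ _) ?nnegrE ?addr_ge0 ?(ltW r0) // sqr_sqrtr ?addr_ge0 ?sqr_ge0 //.
  by rewrite sqrrD expr1n real_normK ?num_real // lerD2r lerDl mulrn_wge0 ?mulr_ge0.
have c0 : cos (atan t) != 0 by rewrite cos_atan invr_eq0 gt_eqF.
have s_def : sin (atan t) = t * cos (atan t).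
  by rewrite -{2}(atanK t) /tan divfK.
exists (ln (x * Num.sqrt (1 + t ^+ 2))), (atan t).
rewrite /polar lnK ?posrE ?mulr_gt0 // s_def cos_atan; split.
- apply/eqP; rewrite eq_complex /=; apply/andP; split; apply/eqP.
    by rewrite mulfK ?gt_eqF.
  by rewrite y_def mulrCA mulfK ?gt_eqF.
- by rewrite ler_peMr // ltW.
- apply: (le_trans (ler_wpM2l (ltW x0) r2)).
  by rewrite mulrDr mulr1 y_def normrM (gtr0_norm x0) [x * _]mulrC.
- apply: (le_trans (normr_atan_le _)).
  by rewrite y_def normrM (gtr0_norm x0) mulfK ?gt_eqF.
Qed.

Variables (w q L eps : R).

(** The image under exp of the n-fold dilate of the triangle a <= L,
    |b| <= eps (w + q a).  For eps > 0 the last condition also bounds a from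
    below, because the width has to be nonnegative. *)
Definition sector n p := exists a b,
  [/\ p = polar a b, a <= n%:R * L & `|b| <= eps * (n%:R * w + q * a)].

Lemma sector0_1 : sector 0 1.
Proof.
by exists 0, 0; rewrite polar00 !(mul0r, mulr0, addr0) normr0.
Qed.

Lemma sectorM m n p p' : sector m p -> sector n p' -> sector (m + n) (p * p').
Proof.
move=> [a [b [-> ha hb]]] [a' [b' [-> ha' hb']]].
exists (a + a'), (b + b'); rewrite polarD natrD; split=> //.
  by rewrite mulrDl lerD.
apply: (le_trans (ler_normD _ _)); apply: (le_trans (lerD hb hb')).
by rewrite -mulrDr; lra.
Qed.

Lemma sectorW m n p : 0 <= w -> 0 <= L -> 0 <= eps -> (m <= n)%N ->
  sector m p -> sector n p.
Proof.
move=> w0 L0 e0 mn [a [b [-> ha hb]]]; exists a, b.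
have mn' : m%:R <= n%:R :> R by rewrite ler_nat.
split=> //; first by rewrite (le_trans ha) // ler_wpM2r.
by rewrite (le_trans hb) // ler_wpM2l // lerD2r ler_wpM2r.
Qed.

End polar_sectors.

(** * Contraction of the sectors *)

Section contraction.
Set Implicit Arguments.
Unset Strict Implicit.
Variable R : realType.
Variables (d : nat) (w q c l1 : R).
Hypotheses (w_gt0 : 0 < w) (q_gt0 : 0 < q) (c_gt0 : 0 < c) (l1_gt0 : 0 < l1).
Hypothesis gap : forall l a : R, 0 <= l <= l1 ->
  l * expR (- a) * (d%:R * w + q * a) + c * (l * expR (- a))
    <= (1 + l * expR (- a)) * (w + q * ln (1 + l * expR (- a))).

(* [B] bounds exp (- a) and [M] the width in every sector of index at most d + 1;
   [L] bounds the logarithmic modulus of a single ratio.  [tau] is the slack in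
   [gap] once the bound M is known; half of it pays for the loss [sigma] of
   logarithmic modulus caused by the angles, the other half for the perturbation
   [eta] of the parameter.  [C] is the rate at which [sigma] consumes the slack.
   The perturbation is measured in units of [eps], as [kappa], because the
   inequality to preserve is homogeneous in [eps]. *)
Let B : R := expR (d.+1%:R * w / q).
Let L : R := ln (2 + B * l1).
Let M : R := d.+1%:R * (w + q * L).
Let tau : R := c * w / (M + c).
Let C : R := (2 + B * l1) * (w + q * L + q).
Let sigma : R := Num.min 1 (Num.min (w / q) (tau / (2 * C))).
Let kappa : R := tau / (2 * B).
Let eps : R := sigma / (2 * B * (l1 * M + kappa)).
Let eta : R := eps * kappa.

Let B_gt0 : 0 < B. Proof. exact: expR_gt0. Qed.
Let E_gt0 : 0 < 2 + B * l1. Proof. by rewrite addr_gt0 // mulr_gt0. Qed.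
Let L_ge0 : 0 <= L.
Proof. by rewrite ln_ge0 //; have := mulr_gt0 B_gt0 l1_gt0; lra. Qed.
Let wqL_gt0 : 0 < w + q * L.
Proof. by rewrite ltr_pwDl // mulr_ge0 // ltW. Qed.
Let M_gt0 : 0 < M. Proof. by rewrite mulr_gt0. Qed.
Let tau_gt0 : 0 < tau. Proof. by rewrite divr_gt0 ?mulr_gt0 ?addr_gt0. Qed.
Let C_gt0 : 0 < C. Proof. by rewrite mulr_gt0 // addr_gt0. Qed.
Let sigma_gt0 : 0 < sigma.
Proof.
have C2_gt0 : 0 < 2 * C by rewrite mulr_gt0.
by rewrite !lt_min ltr01 (divr_gt0 w_gt0 q_gt0) (divr_gt0 tau_gt0 C2_gt0).
Qed.
Let kappa_gt0 : 0 < kappa.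
Proof. exact: divr_gt0 tau_gt0 (mulr_gt0 (ltr0Sn _ 1) B_gt0). Qed.
Let eps_gt0 : 0 < eps.
Proof.
apply: (divr_gt0 sigma_gt0); apply: mulr_gt0 (mulr_gt0 (ltr0Sn _ 1) B_gt0) _.
exact: addr_gt0 (mulr_gt0 l1_gt0 M_gt0) kappa_gt0.
Qed.
Let eta_gt0 : 0 < eta. Proof. exact: mulr_gt0. Qed.
Let sigma_le1 : sigma <= 1. Proof. by rewrite ge_min lexx. Qed.
Let sigma_le_wq : q * sigma <= w.
Proof. by rewrite mulrC -ler_pdivlMr // !ge_min lexx orbT. Qed.
Let sigma_le_tau : sigma * C <= tau / 2.
Proof.
rewrite -ler_pdivlMr // -mulrA -invfM !ge_min lexx.
by rewrite !orbT.
Qed.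
Let eps_budget : B * l1 * (eps * M) + B * eta <= sigma / 2.
Proof.
have den_gt0 : 0 < 2 * B * (l1 * M + kappa).
  apply: mulr_gt0 (mulr_gt0 (ltr0Sn _ 1) B_gt0) _.
  exact: addr_gt0 (mulr_gt0 l1_gt0 M_gt0) kappa_gt0.
have : eps * (2 * B * (l1 * M + kappa)) = sigma by rewrite divfK ?gt_eqF.
rewrite /eta; lra.
Qed.

(** The width is nonnegative, which bounds a from below. *)
Lemma sector_bounds n (a b : R) : (n <= d.+1)%N ->
  a <= n%:R * L -> `|b| <= eps * (n%:R * w + q * a) ->
  expR (- a) <= B /\ n%:R * w + q * a <= M.
Proof.
move=> nd ha hb.
have nd' : n%:R <= d.+1%:R :> R by rewrite ler_nat.
split.
  have : 0 <= n%:R * w + q * a.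
    by rewrite -(pmulr_rge0 _ eps_gt0) (le_trans _ hb).
  rewrite ler_expR ler_pdivlMr // => h.
  have : n%:R * w <= d.+1%:R * w by rewrite ler_wpM2r // ltW.
  lra.
rewrite /M; apply: (@le_trans _ _ (n%:R * (w + q * L))); last by rewrite ler_wpM2r // ltW.
by rewrite mulrDr lerD2l mulrCA ler_wpM2l // ltW.
Qed.

(** With z = l + mu, one has z / P = l exp(-a) cis(-b) + mu / P.  The first term is
    X cis(-b), whose real part is X up to X |b| and whose imaginary part is at
    most X |b|; the second is at most B eta. *)
Lemma perturbed_ratio n (l : R) (z P : R[i]) : (n <= d.+1)%N ->
  0 <= l <= l1 -> `|complex.Re z - l| + `|complex.Im z| <= eta -> sector w q L eps n P ->
  exists a x y, [/\ 1 + z / P = (x +i* y)%C,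
    n%:R * w + q * a <= M, 0 <= l * expR (- a) <= B * l1
    & [/\ 1 + l * expR (- a) - sigma / 2 <= x,
          x + `|y| <= 2 + B * l1 &
          `|y| <= eps * (l * expR (- a) * (n%:R * w + q * a)) + B * eta]].
Proof.
move=> nd /andP[l0 ll1] zl [a [b [-> ha hb]]].
have [aB aM] := sector_bounds nd ha hb.
have [u [v [-> uv]]] : exists u v, z = ((l + u) +i* v)%C /\ `|u| + `|v| <= eta.
  by exists (complex.Re z - l), (complex.Im z); rewrite subrKC; split=> //; case: (z).
exists a, (1 + expR (- a) * ((l + u) * cos b + v * sin b)),
  (expR (- a) * (v * cos b - (l + u) * sin b)).
rewrite invr_polar /polar cosN sinN.
set r := expR (- a); have r0 : 0 < r by exact: expR_gt0.
have X0 : 0 <= l * r by rewrite mulr_ge0 // ltW.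
have XB : l * r <= B * l1 by rewrite mulrC ler_pM // ltW.
have XbM : l * r * `|b| <= B * l1 * (eps * M).
  rewrite ler_pM //; apply: (le_trans hb); by rewrite ler_wpM2l // ltW.
have Xb : l * r * `|b| <= eps * (l * r * (n%:R * w + q * a)).
  by rewrite mulrCA ler_wpM2l.
have ruv : r * (`|u| + `|v|) <= B * eta by rewrite ler_pM // ?ltW // addr_ge0.
have hc := cos_ge_sub_norm b; have hs := normr_sin_le b.
have c1 : `|cos b| <= 1 by rewrite ler_norml cos_geN1 cos_le1.
have s1 : `|sin b| <= 1 by rewrite ler_norml sin_geN1 sin_le1.
have ucv : r * `|u * cos b + v * sin b| <= B * eta.
  apply: le_trans ruv; rewrite ler_wpM2l ?(ltW r0) //.
  by apply: (le_trans (ler_normD _ _)); rewrite !normrM lerD // ler_piMr.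
have vcu : r * `|v * cos b - u * sin b| <= B * eta.
  apply: le_trans ruv; rewrite ler_wpM2l ?(ltW r0) // [leRHS]addrC.
  by apply: (le_trans (ler_normB _ _)); rewrite !normrM lerD // ler_piMr.
have hre : `|r * (u * cos b + v * sin b)| <= B * eta.
  by rewrite normrM gtr0_norm.
have him : `|r * (v * cos b - (l + u) * sin b)| <= l * r * `|b| + B * eta.
  have -> : r * (v * cos b - (l + u) * sin b)
      = r * (v * cos b - u * sin b) - l * r * sin b by ring.
  apply: (le_trans (ler_normB _ _)); rewrite addrC lerD //.
    by rewrite normrM (ger0_norm X0) ler_wpM2l.
  by rewrite normrM gtr0_norm.
split=> //; last first.
- have Xc : l * r * cos b <= l * r.
    by rewrite ler_piMr // cos_le1.
  have Xc' : l * r * (1 - `|b|) <= l * r * cos b by rewrite ler_wpM2l.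
  have -> : 1 + r * ((l + u) * cos b + v * sin b)
      = 1 + l * r * cos b + r * (u * cos b + v * sin b) by ring.
  move: hre; rewrite ler_norml => /andP[hre1 hre2].
  have bud := eps_budget; have sl1 := sigma_le1.
  have Beta0 : 0 <= B * eta by rewrite mulr_ge0 // ltW.
  split; [lra| |exact: (le_trans him (lerD Xb (lexx _)))].
  by move: him; lra.
- by rewrite X0.
- by apply/eqP; rewrite eq_complex /=; apply/andP; split; apply/eqP; ring.
Qed.

Lemma sector_ratio_neq0 n (l : R) (z P : R[i]) : (n <= d.+1)%N ->
  0 <= l <= l1 -> `|complex.Re z - l| + `|complex.Im z| <= eta -> sector w q L eps n P ->
  1 + z / P != 0.
Proof.
move=> nd hl hz hP.
have [a [x [y [-> _ /andP[X0 _] [hx _ _]]]]] := perturbed_ratio nd hl hz hP.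
have x0 : 0 < x by have := sigma_le1; lra.
by rewrite eq_complex /= gt_eqF.
Qed.

(** If 1 + z / P = x + i y has logarithmic modulus b, its argument is at most
    |y| / x, so it suffices that |y| <= eps (w + q b) x.  To first order in eps
    this is [gap]; [margin] makes the slack uniform in X. *)
Lemma sector_ratio (l : R) (z P : R[i]) :
  0 <= l <= l1 -> `|complex.Re z - l| + `|complex.Im z| <= eta -> sector w q L eps d P ->
  sector w q L eps 1 (1 + z / P).
Proof.
move=> hl hz hP.
have [a [x [y [-> aM /andP[X0 XB] [hx hxy hy]]]]] := perturbed_ratio (leqnSn d) hl hz hP.
have hgap := gap a hl.
set X := l * expR (- a) in X0 XB hx hy hgap.
set A := d%:R * w + q * a in aM hy hgap.
clearbody X A.
have x0 : 0 < x by have := sigma_le1; lra.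
have X1 : 0 < 1 + X by lra.
set g := ln (1 + X) in hgap.
have g0 : 0 <= g by rewrite ln_ge0 // lerDl.
have gL : g <= L by rewrite ler_ln ?posrE //; lra.
have expRg : expR g = 1 + X by rewrite lnK ?posrE.
clearbody g.
(* For X near 0 the slack c X of [gap] degenerates, but then X A is small
   compared with w.  Writing H for the right-hand side, the two regimes combine:
   c (H - X A) + M (H - X A) >= c (w - X A) + M c X >= c w. *)
have margin : X * A + tau <= (1 + X) * (w + q * g).
  rewrite -lerBrDl ler_pdivrMr ?addr_gt0 //.
  have h1 : w <= (1 + X) * (w + q * g).
    have := mulr_ge0 (ltW X1) (mulr_ge0 (ltW q_gt0) g0).
    have : 0 <= X * w by rewrite mulr_ge0 // ltW.
    lra.
  have h2 : c * w <= c * ((1 + X) * (w + q * g)) by rewrite ler_wpM2l // ltW.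
  have h3 : M * (X * A + c * X) <= M * ((1 + X) * (w + q * g)).
    by rewrite ler_wpM2l // ltW.
  have h4 : c * X * A <= c * X * M by rewrite ler_wpM2l // mulr_ge0 // ltW.
  by lra.
have [b [t [-> hxb hbxy ht]]] := polar_right_half_plane y x0.
exists b, t; split=> //.
  rewrite mul1r -(expRK b) ler_ln ?posrE ?expR_gt0 //.
  exact: le_trans hbxy hxy.
apply: (le_trans ht); rewrite ler_pdivrMr // mul1r.
have gb : g - sigma <= b.
  rewrite -ler_expR; apply: le_trans hxb; apply: le_trans hx.
  rewrite expRB expRg ler_pdivrMr ?expR_gt0 //.
  apply: (@le_trans _ _ ((1 + X - sigma / 2) * (1 + sigma))).
    have := mulr_ge0 X0 (ltW sigma_gt0).
    have sigma1 : 0 <= 1 - sigma by rewrite subr_ge0; exact: sigma_le1.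
    by have := mulr_ge0 (ltW sigma_gt0) sigma1; lra.
  rewrite ler_wpM2l ?expR_ge1Dx //; have := sigma_le1; lra.
have xX : (1 + X) * (1 - sigma) <= x.
  apply: le_trans hx; have := mulr_ge0 X0 (ltW sigma_gt0); have := sigma_gt0; lra.
have K0 : 0 <= w + q * (g - sigma).
  by have := sigma_le_wq; have := mulr_ge0 (ltW q_gt0) g0; lra.
have Kb : w + q * (g - sigma) <= w + q * b by rewrite lerD2l ler_wpM2l // ltW.
apply: (le_trans hy).
have : X * A + B * kappa <= (w + q * b) * x.
  have h1 : (w + q * (g - sigma)) * ((1 + X) * (1 - sigma)) <= (w + q * b) * x.
    rewrite ler_pM // mulr_ge0 ?(ltW X1) // subr_ge0; exact: sigma_le1.
  have h2 : sigma * ((1 + X) * (w + q * g + q)) <= sigma * C.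
    rewrite ler_wpM2l ?(ltW sigma_gt0) // ler_pM ?(ltW X1) //.
    - by have := mulr_ge0 (ltW q_gt0) g0; have := w_gt0; have := q_gt0; lra.
    - lra.
    - by rewrite lerD2r lerD2l ler_wpM2l // ltW.
  have h3 : 0 <= (1 + X) * (q * (sigma * sigma)) by rewrite !mulr_ge0 ?ltW.
  have h4 := sigma_le_tau.
  have h5 : B * kappa = tau / 2 by rewrite /kappa; field; rewrite gt_eqF.
  by lra.
move/(ler_wpM2l (ltW eps_gt0)); rewrite /eta; lra.
Qed.

(** Index d + 1 serves a root with Delta neighbours; no sector need contain the
    resulting ratio, which only has to be nonzero. *)
Lemma contracting_sectors : exists L' eps' eta' : R,
  [/\ 0 <= L', 0 <= eps', 0 < eta' &
    forall (l : R) (z P : R[i]), 0 <= l <= l1 ->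
      `|complex.Re z - l| + `|complex.Im z| <= eta' ->
      (sector w q L' eps' d P -> sector w q L' eps' 1 (1 + z / P)) /\
      (sector w q L' eps' d.+1 P -> 1 + z / P != 0)].
Proof.
exists L, eps, eta; split=> // [|l z P hl hz]; first exact: ltW.
by split; [exact: sector_ratio hl hz | exact: sector_ratio_neq0 (leqnn _) hl hz].
Qed.

End contraction.

(** * Ratios of independence polynomials *)

Section independence_ratios.
(* Restores the meaning of lemma names shared with classical sets. *)
Import boot.fintype boot.finset.
Set Implicit Arguments.
Unset Strict Implicit.
Variables (K : fieldType) (G : sgraph) (z : K).
Implicit Types (S T A I J : {set G}) (u v : G).

Definition nbr v : {set G} := [set u | edge v u].

Definition indep_poly_in S : K :=
  \sum_(I : {set G} | independent I && (I \subset S)) z ^+ #|I|.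

Lemma indep_poly_inT : indep_poly_in [set: G] = indep_poly G z.
Proof. by apply: eq_bigl => I; rewrite subsetT andbT. Qed.

Lemma independentP I :
  reflect {in I &, forall u v, ~~ edge u v} (independent I).
Proof.
apply: (iffP forallP) => [h u v uI vI|h u].
  by have /implyP/(_ uI)/forallP/(_ v)/implyP/(_ vI) := h u.
by apply/implyP => uI; apply/forallP => v; apply/implyP => vI; exact: h.
Qed.

Lemma independentS I J : I \subset J -> independent J -> independent I.
Proof.
move=> /subsetP IJ /independentP hJ; apply/independentP => u v uI vI.
by apply: hJ; apply: IJ.
Qed.

Lemma independentU1 v J : v \notin J ->
  independent (v |: J) = independent J && [disjoint J & nbr v].
Proof.
move=> vJ; apply/idP/andP => [h|[/independentP hJ dJ]].
  split; first by apply: independentS h; rewrite subsetUr.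
  rewrite disjoint_subset; apply/subsetP => u uJ; rewrite !inE.
  by move/independentP: h; apply; rewrite !inE ?eqxx ?uJ ?orbT.
have nJ u : u \in J -> ~~ edge v u.
  by move=> uJ; have := disjointFr dJ uJ; rewrite inE => ->.
apply/independentP => x y; rewrite !inE.
move=> /predU1P[->|xJ] /predU1P[->|yJ].
- by rewrite edge_irrefl.
- exact: nJ.
- by rewrite edge_sym nJ.
- exact: hJ.
Qed.

Lemma indep_poly_in0 : indep_poly_in set0 = 1.
Proof.
rewrite /indep_poly_in (big_pred1 set0) ?cards0 ?expr0 // => I /=.
rewrite subset0; case: eqVneq => [->|]; rewrite ?andbF //= andbT.
by apply/independentP => u; rewrite inE.
Qed.

(** The independent sets containing v correspond, by removing v, to the
    independent sets avoiding v and its neighbours. *)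
Lemma indep_poly_in_rec v S : v \in S ->
  indep_poly_in S = indep_poly_in (S :\ v) + z * indep_poly_in (S :\ v :\: nbr v).
Proof.
move=> vS; rewrite /indep_poly_in (bigID (fun I => v \in I)) /= addrC.
congr (_ + _); first by apply: eq_bigl => I; rewrite subsetD1 andbA.
rewrite big_distrr /= (reindex_onto (fun J => v |: J) (fun I => I :\ v)) /=; last first.
  by move=> I /andP[_ vI]; rewrite setD1K.
have cond J : independent (v |: J) && (v |: J \subset S) && (v \in v |: J)
      && ((v |: J) :\ v == J)
    = independent J && (J \subset S :\ v :\: nbr v).
  rewrite setU11 andbT; have [vJ|vJ] := boolP (v \in J).
    rewrite [X in _ && X](_ : _ = false); last first.
      by apply/eqP => /setP/(_ v); rewrite !inE eqxx vJ.
    rewrite andbF; apply/esym/negbTE; rewrite negb_and; apply/orP; right.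
    by apply/subsetPn; exists v; rewrite // !inE eqxx andbF.
  rewrite setU1K // eqxx andbT independentU1 // subUset sub1set vS /=.
  by rewrite subsetD subsetD1 vJ andbT -andbA [[disjoint _ & _] && _]andbC.
rewrite (eq_bigl _ _ cond); apply: eq_bigr => J /andP[_ sJ].
have vJ : v \notin J.
  by apply: contraTN sJ => vJ; apply/subsetPn; exists v; rewrite // !inE eqxx andbF.
by rewrite cardsU1 vJ exprS.
Qed.

(* U n plays the role of the set of products of n elements of a region U 1. *)
Variables (d : nat) (U : nat -> K -> Prop).
Hypothesis U0_1 : U 0 1.
Hypothesis U_mul : forall m n p p', U m p -> U n p' -> U (m + n) (p * p').
Hypothesis U_mono : forall m n p, (m <= n)%N -> U m p -> U n p.
Hypothesis U_ratio : forall P, U d P -> U 1 (1 + z / P).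
Hypothesis U_ratio_neq0 : forall P, U d.+1 P -> 1 + z / P != 0.

Definition controlled S := indep_poly_in S != 0 /\
  forall v, v \in S -> (#|nbr v :&: S| <= d)%N ->
    U 1 (indep_poly_in S / indep_poly_in (S :\ v)).

(** Remove the vertices of A one at a time: degrees inside T only decrease, so
    each of the #|A| successive ratios lies in U 1. *)
Lemma controlled_telescope T A :
  (forall T', T' \subset T -> controlled T') -> A \subset T ->
  {in A, forall u, (#|nbr u :&: T| <= d)%N} ->
  U #|A| (indep_poly_in T / indep_poly_in (T :\: A)).
Proof.
have [n] := ubnP #|A|; elim: n T A => // n IHn T A An cT sA dA.
have [->|/set0Pn[u uA]] := eqVneq A set0.
  by rewrite cards0 setD0 divff //; have [] := cT T (subxx _).
have uT : u \in T by rewrite (subsetP sA).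
have [nT hT] := cT T (subxx _).
have [nTu _] := cT (T :\ u) (subsetDl _ _).
have -> : indep_poly_in T / indep_poly_in (T :\: A) =
    indep_poly_in T / indep_poly_in (T :\ u) *
    (indep_poly_in (T :\ u) / indep_poly_in (T :\ u :\: (A :\ u))).
  rewrite mulrA divfK //; congr (_ / indep_poly_in _).
  apply/setP => x; rewrite !inE; have [->|] := eqVneq x u; rewrite //= uA //.
rewrite (cardsD1 u) uA; apply: U_mul; first by apply: hT => //; exact: dA.
apply: IHn.
- by move: An; rewrite (cardsD1 u A) uA.
- by move=> T' sT'; apply: cT; apply: subset_trans sT' (subsetDl _ _).
- by rewrite setSD.
move=> x; rewrite !inE => /andP[_ xA]; apply: leq_trans (dA x xA).
by apply: subset_leq_card; rewrite setIS ?subsetDl.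
Qed.

(** Induction on the size of S.  The neighbours of v in S have at most d
    neighbours in S - v, because v itself is gone; so [controlled_telescope]
    applies to them and puts P = Z_(S - v) / Z_(S - N[v]) in the U of index
    #|nbr v :&: S|. *)
Lemma all_controlled : (max_degree G <= d.+1)%N -> forall S, controlled S.
Proof.
move=> hdeg; have deg v : (#|nbr v| <= d.+1)%N.
  apply: leq_trans hdeg; rewrite cardsE.
  exact: (leq_bigmax_cond (F := @degree G) v isT).
move=> S; have [n] := ubnP #|S|; elim: n S => // n IHn S Sn.
have main v : v \in S -> exists P,
    [/\ indep_poly_in (S :\ v) != 0,
        indep_poly_in S = indep_poly_in (S :\ v) * (1 + z / P) &
        U #|nbr v :&: S| P].
  move=> vS.
  have cT T' : T' \subset S :\ v -> controlled T'.
    move=> sT'; apply: IHn; move: Sn; rewrite (cardsD1 v) vS ltnS.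
    by apply: leq_trans; rewrite ltnS subset_leq_card.
  have [nT _] := cT _ (subxx _).
  set A := nbr v :&: S.
  have sA : A \subset S :\ v.
    apply/subsetP => u; rewrite !inE => /andP[evu ->]; rewrite andbT.
    by apply: contraTneq evu => ->; rewrite edge_irrefl.
  have eA : S :\ v :\: A = S :\ v :\: nbr v.
    by apply/setP => u; rewrite !inE; case: (u \in S); rewrite ?andbT ?andbF.
  have [nTA _] := cT (S :\ v :\: A) (subsetDl _ _).
  exists (indep_poly_in (S :\ v) / indep_poly_in (S :\ v :\: A)); split=> //.
    rewrite mulrDr mulr1 invf_div mulrCA [X in z * X]mulrC divfK // eA.
    exact: indep_poly_in_rec.
  apply: controlled_telescope => // u; rewrite inE => /andP[].
  rewrite inE => evu _; rewrite -ltnS; apply: leq_trans (deg u).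
  rewrite (cardsD1 v (nbr u)) inE edge_sym evu ltnS; apply: subset_leq_card.
  by apply/subsetP => x; rewrite !inE => /andP[-> /andP[->]].
split=> [|v vS dv]; last first.
  have [P [n0 -> hP]] := main v vS.
  by rewrite mulrAC divff // mul1r; apply: U_ratio; exact: U_mono hP.
have [->|/set0Pn[v vS]] := eqVneq S set0.
  by rewrite indep_poly_in0 oner_eq0.
have [P [n0 -> hP]] := main v vS.
rewrite mulf_neq0 //; apply: U_ratio_neq0; apply: U_mono hP.
by apply: leq_trans (deg v); rewrite subset_leq_card ?subsetIl.
Qed.

Lemma indep_poly_neq0 : (max_degree G <= d.+1)%N -> indep_poly G z != 0.
Proof.
by move=> /all_controlled/(_ [set: G])[]; rewrite indep_poly_inT.
Qed.

End independence_ratios.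

(** * The zero-free domain *)

Section zero_free_domain.
Set Implicit Arguments.
Unset Strict Implicit.
Variable R : realType.
Local Open Scope complex_scope.

Lemma norm_real_complex (x : R) : `|x%:C| = `|x|%:C.
Proof. by rewrite normc_def /= expr0n addr0 sqrtr_sqr. Qed.

Lemma ltr_real_complex (x y : R) : (x%:C < y%:C) = (x < y).
Proof. by rewrite ltcE /= eqxx. Qed.

Lemma norm_lt_Re_Im (z : R[i]) (r : R) :
  `|z| < r%:C -> `|complex.Re z| < r /\ `|complex.Im z| < r.
Proof.
rewrite normc_def ltr_real_complex => h.
by split; apply: le_lt_trans h; rewrite -sqrtr_sqr ler_wsqrtr // ?lerDl ?lerDr sqr_ge0.
Qed.

Definition zero_free (d : nat) (z : R[i]) : Prop :=
  forall G : sgraph, (max_degree G <= d.+1)%N -> indep_poly G z != 0.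

Lemma zero_free_tube (d : nat) (l1 : R) : (1 < d)%N ->
  0 < l1 < lambda_crit R d.+1 ->
  exists2 eta : R, 0 < eta & forall (l : R) (z : R[i]), 0 <= l <= l1 ->
    `|l%:C - z| < eta%:C -> zero_free d z.
Proof.
move=> d1 hl1; have [c c0 gap] := subcritical_gap d1 hl1.
have /andP[l10 _] := hl1.
have [L [eps [eta [L0 eps0 eta0 hU]]]] :=
  contracting_sectors (offset_gt0 R d1) (slope_gt0 R d1) c0 l10 gap.
exists (eta / 2) => [|l z hl]; first by rewrite divr_gt0.
rewrite distrC => /norm_lt_Re_Im []; rewrite /= => hre him G.
have hz : `|complex.Re z - l| + `|complex.Im z| <= eta.
  by move: hre him; case: (z) => x y /=; rewrite subr0; lra.
have w0 := ltW (offset_gt0 R d1).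
apply: (indep_poly_neq0 (U := sector (offset R d) (slope R d) L eps)).
- exact: sector0_1.
- exact: sectorM.
- by move=> m n p mn; exact: sectorW.
- by move=> P; have [] := hU l z P hl hz.
- by move=> P; have [] := hU l z P hl hz.
Qed.

Lemma star_shaped_connected (S : set R[i]^o) :
  (forall (t : R) (z : R[i]), 0 <= t <= 1 -> S z -> S (t%:C * z)) -> connected S.
Proof.
move=> starS.
have -> : S = (\bigcup_(z in S) ((fun t : R => t%:C * z : R[i]^o) @` `[0%R, 1%R]))%classic.
  apply/seteqP; split => [z Sz|_ [z Sz [t /= t01 <-]]].
    by exists z => //; exists 1 => /=; rewrite ?mul1r // in_itv /= ler01 lexx.
  by apply: starS; rewrite // in_itv in t01.
apply: bigcup_connected.
  by exists 0 => z Sz; exists 0 => /=; rewrite ?mul0r // in_itv /= ler01 lexx.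
move=> z _; apply: connected_continuous_connected; first exact: segment_connected.
apply: continuous_subspaceT => t; apply/cvgrPdist_lt => e.
case: e => e ei; rewrite ltcE /= => /andP[/eqP -> e0].
have N0 : 0 < 1 + complex.Re `|z|.
  by rewrite normc_def /= ltr_pwDl ?sqrtr_ge0.
have d0 : 0 < e / (1 + complex.Re `|z|) by rewrite divr_gt0.
near=> u.
have hu : `|t - u| < e / (1 + complex.Re `|z|).
  by near: u; exact: cvgr_dist_lt d0.
rewrite -mulrBl -rmorphB /= normrM norm_real_complex.
have -> : `|z| = (complex.Re `|z|)%:C by rewrite normc_def.
rewrite -rmorphM /= ltr_real_complex.
move: hu; rewrite ltr_pdivlMr // mulrDr mulr1; apply: le_lt_trans.
by rewrite lerDr.
Unshelve. all: by end_near. Qed.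

End zero_free_domain.

Theorem theorem1p1 (R : realType) (Delta : nat) (hDelta : (3 <= Delta)%N) :
  exists D : set R[i]^o,
    [/\ complex_domain D,
        forall x : R, 0 <= x < lambda_crit R Delta -> D (x%:C)%C
      & forall (G : sgraph) (z : R[i]),
          (max_degree G <= Delta)%N -> D z -> indep_poly G z <> 0 ].
Proof.
case: Delta hDelta => // d; rewrite ltnS => d1.
(* [good] collects the pairs (l, eta) for which the eta-neighbourhood of the
   whole segment [0, l], and not just of its endpoint, is zero-free: this is what
   makes the union of balls star-shaped. *)
pose good := [set p : R * R | 0 <= p.1 /\ forall (l : R) (z : R[i]),
  0 <= l <= p.1 -> `|l%:C%C - z| < p.2%:C%C -> zero_free d z]%classic.
pose D : set R[i]^o := (\bigcup_(p in good) ball (p.1%:C%C : R[i]^o) (p.2%:C%C))%classic.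
have inD z : D z <-> exists2 p, good p & `|p.1%:C%C - z| < p.2%:C%C.
  by split=> -[p gp hp]; exists p => //; move: hp; rewrite -ball_normE.
exists D; split.
- split; first by apply: bigcup_open => p _; exact: ball_open.
  apply: star_shaped_connected => t z /andP[t0 t1] /inD[[l eta] [/= l0 hl] hz].
  apply/inD; exists (t * l, eta) => /=.
    split=> [|l' z' /andP[l'0 l'l]]; first by rewrite mulr_ge0.
    by apply: hl; rewrite l'0 (le_trans l'l) // ler_piMl.
  rewrite rmorphM -mulrBr normrM norm_real_complex (ger0_norm t0).
  apply: le_lt_trans hz; rewrite ler_piMl //.
  by rewrite lecE /= eqxx.
- move=> x /andP[x0 xc]; pose l1 := (x + lambda_crit R d.+1) / 2.
  have hl1 : 0 < l1 < lambda_crit R d.+1 by apply/andP; rewrite /l1; split; lra.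
  have xl1 : x <= l1 by rewrite /l1; lra.
  have [eta eta0 heta] := zero_free_tube d1 hl1.
  apply/inD; exists (x, eta) => /=; last first.
    by rewrite subrr normr0 ltr_real_complex.
  by split=> // l z /andP[l0 lx]; apply: heta; rewrite l0 (le_trans lx).
- move=> G z hG /inD[[l eta] [/= l0 hl] hz]; apply/eqP.
  by apply: (hl l z) hG => //; rewrite l0 lexx.
Qed.
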